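(* Let $G_{1,1}$ be the group with presentation $\langle a,b,c,d,s,t \mid c=ab=ba,\ d=ab^{-1},\ s^{-1}as=c,\ t^{-1}at=d\rangle$ and let $X=\{a^{\pm1},b^{\pm1},c^{\pm1},d^{\pm1},s^{\pm1},t^{\pm1}\}$. Then all patterns for $(G_{1,1},X)$ are of the form $$(-1)(0,-1)(0)(1,0)(1).$$ That is, for every strip in the Cayley graph $\Gamma(G_{1,1},X)$ and either orientation of it, the associated bi-infinite sequence is the concatenation, in this order, of: a left-infinite string all of whose entries are $-1$; a finite (possibly empty) word in $\{0,-1\}$; a finite (possibly empty) string of $0$'s; a finite (possibly empty) word in $\{1,0\}$; and a right-infinite string all of whose entries are $1$.
   Context: $d(\cdot,\cdot)$ is the word metric on $G_{1,1}$ with respect to $X$. The group $G_{1,1}$ is a double HNN extension of $A=\langle a,b\rangle\cong\mathbb{Z}^2$ with stable letters $s$ (conjugating $\langle a\rangle$ to $\langle c\rangle$) and $t$ (conjugating $\langle a\rangle$ to $\langle d\rangle$). A plane is a copy in $\Gamma(G_{1,1},X)$ of the Cayley graph of $A$, with vertex set a left coset $gA$. A strip consists of all the edges labelled $s$ from $ga^i$ to $ga^is=gsc^i$ ($i\in\mathbb{Z}$), for some $g\in G_{1,1}$, or all the edges labelled $t$ from $ga^i$ to $ga^it=gtd^i$ ($i\in\mathbb{Z}$); its two sides are the lines $\{ga^i\}$ and $\{gsc^i\}$ (respectively $\{ga^i\}$ and $\{gtd^i\}$), lying in two different planes. Removing the (open) edges of a strip separates the Cayley graph into two components, each containing one side of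 the strip; the near side is the side lying in the component containing the identity $1$. Sequence of a strip: write the near side of the strip as $(p_i)_{i\in\mathbb{Z}}$ with $p_i=hx^i$, where $x\in\{a,c,d\}$ is the generator labelling the near side (the $p_i$ are the crossing points of the strip; replacing $x$ by $x^{-1}$ gives the opposite orientation). The sequence of the strip is the bi-infinite sequence $\big(d(1,p_{i+1})-d(1,p_i)\big)_{i\in\mathbb{Z}}$, with entries in $\{0,\pm1\}$. A pattern is an expression $(-1)(q_1)\cdots(q_k)(1)$ recording the shape of such a sequence: each $q_j$ is a finite word in $\{0,\pm1\}$ and $(q_j)$ stands for a finite number of repeats of $q_j$, while the terminal terms $(-1)$ and $(1)$ stand for infinite repeats. In abbreviated form, $(1,0)$ denotes any finite mixture of $0$'s and $1$'s and $(0,-1)$ any finite mixture of $0$'s and $-1$'s. The patterns for $(G_{1,1},X)$ are those realized by sequences of strips in its Cayley graph. *)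

(* Defs.v *)
From HB Require Import structures.
From mathcomp Require Import all_boot all_order all_algebra.
From mathcomp Require Import boolp.

Set Implicit Arguments.
Unset Strict Implicit.
Unset Printing Implicit Defensive.

Local Open Scope quotient_scope.
Local Open Scope group_scope.

Section PresentedGroup.
Variable X : choiceType.

(* A letter (x, false) stands for x, and (x, true) for x^-1. *)
Definition letter : Type := X * bool.
Definition word : Type := seq letter.

Definition linv (l : letter) : letter := (l.1, ~~ l.2).
Definition winv (w : word) : word := rev (map linv w).

Variable R : seq (word * word).

Inductive pres_eq : word -> word -> Prop :=
| pres_refl u : pres_eq u u
| pres_sym u v : pres_eq u v -> pres_eq v u
| pres_trans u v w : pres_eq u v -> pres_eq v w -> pres_eq u w
| pres_cat u u' v v' :
    pres_eq u u' -> pres_eq v v' -> pres_eq (u ++ v) (u' ++ v')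
| pres_cancel l : pres_eq [:: l; linv l] [::]
| pres_rel u v : (u, v) \in R -> pres_eq u v.

Definition pres_eqb : rel word := fun u v => `[< pres_eq u v >].

Lemma pres_eqb_refl : reflexive pres_eqb.
Proof. by move=> u; apply/asboolP; exact: pres_refl. Qed.

Lemma pres_eqb_sym : symmetric pres_eqb.
Proof. by move=> u v; apply/asboolP/asboolP => /pres_sym. Qed.

Lemma pres_eqb_trans : transitive pres_eqb.
Proof.
by move=> v u w /asboolP uv /asboolP vw; apply/asboolP; exact: pres_trans vw.
Qed.

Canonical pres_equiv :=
  EquivRel pres_eqb pres_eqb_refl pres_eqb_sym pres_eqb_trans.

Definition presented : Type := {eq_quot pres_equiv}.
HB.instance Definition _ := Choice.on presented.

Definition wclass (w : word) : presented := \pi_{eq_quot pres_equiv}%qT w.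
Definition wrepr (g : presented) : word :=
  repr (g : {eq_quot pres_equiv}).

Lemma wreprK g : wclass (wrepr g) = g.
Proof. exact: reprK. Qed.

Lemma wclassP u v : wclass u = wclass v <-> pres_eq u v.
Proof.
split=> [/eqmodP/asboolP //|uv].
by apply/eqmodP/asboolP.
Qed.

Lemma linvK : involutive linv.
Proof. by case=> x b; rewrite /linv /= negbK. Qed.

Lemma winvK : involutive winv.
Proof. by move=> w; rewrite /winv map_rev revK mapK //; exact: linvK. Qed.

Lemma winv_cons l w : winv (l :: w) = winv w ++ [:: linv l].
Proof. by rewrite /winv /= rev_cons cats1. Qed.

Lemma pres_mulwV w : pres_eq (w ++ winv w) [::].
Proof.
elim: w => [|l w IHw]; first exact: pres_refl.
rewrite winv_cons catA cat_cons.
apply: (pres_trans _ (pres_cancel l)).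
rewrite -[l :: (w ++ _)]cat1s -catA -[[:: l; _]]cat1s.
by apply: (pres_cat (pres_refl _)); exact: (pres_cat IHw (pres_refl _)).
Qed.

Lemma pres_winv u v : pres_eq u v -> pres_eq (winv u) (winv v).
Proof.
move=> uv.
have Vuu : pres_eq (winv u ++ u) [::].
  by have := pres_mulwV (winv u); rewrite winvK.
have h1 : pres_eq (winv u) (winv u ++ (v ++ winv v)).
  rewrite -{1}[winv u]cats0.
  exact: (pres_cat (pres_refl _) (pres_sym (pres_mulwV v))).
apply: (pres_trans h1); rewrite catA -{2}[winv v]cat0s.
apply: pres_cat (pres_refl _); apply: (pres_trans _ Vuu).
exact: (pres_cat (pres_refl _) (pres_sym uv)).
Qed.

Definition pres_one : presented := wclass [::].
Definition pres_mul (g h : presented) : presented :=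
  wclass (wrepr g ++ wrepr h).
Definition pres_inv (g : presented) : presented := wclass (winv (wrepr g)).

Lemma wrepr_class w : pres_eq (wrepr (wclass w)) w.
Proof. by apply/wclassP; rewrite wreprK. Qed.

Lemma wclass_mul u v : pres_mul (wclass u) (wclass v) = wclass (u ++ v).
Proof. by apply/wclassP; apply: pres_cat; exact: wrepr_class. Qed.

Lemma wclass_inv u : pres_inv (wclass u) = wclass (winv u).
Proof. by apply/wclassP; apply: pres_winv; exact: wrepr_class. Qed.

Lemma pres_mulA : associative pres_mul.
Proof.
move=> g h k; rewrite -(wreprK g) -(wreprK h) -(wreprK k).
by rewrite !wclass_mul catA.
Qed.

Lemma pres_mul1g : left_id pres_one pres_mul.
Proof. by move=> g; rewrite -(wreprK g) wclass_mul. Qed.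

Lemma pres_mulg1 : right_id pres_one pres_mul.
Proof. by move=> g; rewrite -(wreprK g) wclass_mul cats0. Qed.

Lemma pres_mulgV : right_inverse pres_one pres_inv pres_mul.
Proof.
move=> g; rewrite -(wreprK g) wclass_inv wclass_mul.
by apply/wclassP; exact: pres_mulwV.
Qed.

Lemma pres_mulVg : left_inverse pres_one pres_inv pres_mul.
Proof.
move=> g; rewrite -(wreprK g) wclass_inv wclass_mul.
by apply/wclassP; have := pres_mulwV (winv (wrepr g)); rewrite winvK.
Qed.

HB.instance Definition _ := isGroup.Build presented
  pres_mulA pres_mul1g pres_mulg1 pres_mulVg pres_mulgV.

Definition pres_gen (x : X) : presented := wclass [:: (x, false)].

Definition letter_val (l : letter) : presented :=
  if l.2 then (pres_gen l.1)^-1 else pres_gen l.1.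
Definition word_val (w : word) : presented := \prod_(l <- w) letter_val l.

Lemma word_valE w : word_val w = wclass w.
Proof.
elim: w => [|[x b] w IHw]; first by rewrite /word_val big_nil.
rewrite /word_val big_cons -/(word_val w) IHw -cat1s -wclass_mul.
congr (_ * _); case: b => //.
by rewrite /letter_val /= /pres_gen [LHS]wclass_inv.
Qed.

Lemma word_val_rel u v : (u, v) \in R -> word_val u = word_val v.
Proof. by move=> uv; rewrite !word_valE; apply/wclassP; exact: pres_rel. Qed.

Definition within (g h : presented) (n : nat) : bool :=
  `[< exists2 w : word, size w = n & h = g * word_val w >].

Lemma within_ex g h : exists n, within g h n.
Proof.
exists (size (wrepr (g^-1 * h))); apply/asboolP.
by exists (wrepr (g^-1 * h)); rewrite // word_valE wreprK mulVKg.
Qed.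

Definition word_dist (g h : presented) : nat := ex_minn (within_ex g h).

(* The edge of the Cayley graph labelled x from g to g x is the pair (g, x).
   Crossing it backwards, from g x to g, reads the letter (x, true). *)
Definition crossed_edge (g : presented) (l : letter) : presented * X :=
  (if l.2 then g * letter_val l else g, l.1).

Fixpoint path_avoids (E : presented * X -> Prop) (g : presented) (w : word) :
    Prop :=
  if w is l :: w' then
    ~ E (crossed_edge g l) /\ path_avoids E (g * letter_val l) w'
  else True.

(* g and h lie in the same component of the graph without the edges in E *)
Definition connected_off (E : presented * X -> Prop) (g h : presented) : Prop :=
  exists2 w : word, path_avoids E g w & h = g * word_val w.

End PresentedGroup.

Definition expgz (G : groupType) (x : G) (i : int) : G :=
  match i with Posz n => x ^+ n | Negz n => x ^- n.+1 end.

Inductive gen := Ga | Gb | Gc | Gd | Gs | Gt.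

Definition gen_code (x : gen) : nat :=
  match x with Ga => 0 | Gb => 1 | Gc => 2 | Gd => 3 | Gs => 4 | Gt => 5 end%N.
Definition gen_decode (n : nat) : gen := nth Ga [:: Ga; Gb; Gc; Gd; Gs; Gt] n.
Lemma gen_codeK : cancel gen_code gen_decode. Proof. by case. Qed.
HB.instance Definition _ := Countable.copy gen (can_type gen_codeK).

Definition pos (x : gen) : letter gen := (x, false).
Definition neg (x : gen) : letter gen := (x, true).

Definition G11_relations : seq (word gen * word gen) :=
  [:: ([:: pos Gc], [:: pos Ga; pos Gb]);
      ([:: pos Ga; pos Gb], [:: pos Gb; pos Ga]);
      ([:: pos Gd], [:: pos Ga; neg Gb]);
      ([:: neg Gs; pos Ga; pos Gs], [:: pos Gc]);
      ([:: neg Gt; pos Ga; pos Gt], [:: pos Gd])].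

Definition G11 : groupType := presented G11_relations.

Definition gval (x : gen) : G11 := pres_gen G11_relations x.

Inductive stable := St_s | St_t.
Definition stable_gen (u : stable) : gen :=
  match u with St_s => Gs | St_t => Gt end.
Definition stable_target (u : stable) : gen :=
  match u with St_s => Gc | St_t => Gd end.

(* The strip through the stable-letter edge starting at strip_base;
   strip_base can be replaced by strip_base * a^i without changing the strip. *)
Record strip := Strip { strip_base : G11; strip_letter : stable }.

Definition strip_edge (S : strip) (e : G11 * gen) : Prop :=
  e.2 = stable_gen (strip_letter S) /\
  exists i : int, e.1 = strip_base S * expgz (gval Ga) i.

Inductive side := Initial | Terminal.

Definition side_base (S : strip) (z : side) : G11 :=
  match z with
  | Initial => strip_base S
  | Terminal => strip_base S * gval (stable_gen (strip_letter S))
  end.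
Definition side_label (S : strip) (z : side) : gen :=
  match z with Initial => Ga | Terminal => stable_target (strip_letter S) end.

(* The crossing points p_i = h x^i, or h (x^-1)^i if reversed. *)
Definition side_point (S : strip) (z : side) (reversed : bool) (i : int) :
    G11 :=
  side_base S z *
    expgz (letter_val G11_relations (side_label S z, reversed)) i.

Definition near_side (S : strip) (z : side) : Prop :=
  forall i : int, connected_off (strip_edge S) (1 : G11) (side_point S z false i).

Lemma connected_off_trans (X : choiceType) (R : seq (word X * word X))
    (E : presented R * X -> Prop) g h k :
  connected_off E g h -> connected_off E h k -> connected_off E g k.
Proof.
case=> u Eu -> [v Ev ->]; exists (u ++ v); last first.
  by rewrite /word_val big_cat mulgA.
elim: u g Eu Ev => [|l u IHu] g /=.
  by move=> _; rewrite /word_val big_nil mulg1.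
case=> El Eu Ev; split=> //; apply: IHu => //.
by move: Ev; rewrite /word_val big_cons mulgA.
Qed.

Lemma off_strip (S : strip) (g : G11) (w : word gen) :
  {in w, forall l, l.1 != stable_gen (strip_letter S)} ->
  connected_off (strip_edge S) g (g * word_val G11_relations w).
Proof.
move=> Hw; exists w => //.
elim: w g Hw => //= l w IHw g Hw; split.
  by case=> /= /eqP; rewrite (negPf (Hw l _)) // mem_head.
by apply: IHw => k kw; apply: Hw; rewrite inE kw orbT.
Qed.

Lemma off_strip_exp (S : strip) (g : G11) (x : gen) (b : bool) n :
  x != stable_gen (strip_letter S) ->
  connected_off (strip_edge S) g (g * letter_val G11_relations (x, b) ^+ n).
Proof.
move=> xS; have -> : letter_val G11_relations (x, b) ^+ n =
    word_val G11_relations (nseq n (x, b)).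
  by elim: n => [|n IHn]; rewrite /word_val ?big_nil //= big_cons expgS IHn.
by apply: off_strip => l /nseqP [-> _].
Qed.

Lemma side_connected (S : strip) z i :
  connected_off (strip_edge S) (side_base S z) (side_point S z false i)
  /\ connected_off (strip_edge S) (side_point S z false i) (side_base S z).
Proof.
have xS : side_label S z != stable_gen (strip_letter S).
  by case: z; case: S => g [].
rewrite /side_point; set h := side_base S z.
have neg_val : letter_val G11_relations (side_label S z, true) =
  (letter_val G11_relations (side_label S z, false))^-1 by [].
case: i => n; split.
- exact: off_strip_exp.
- have := off_strip_exp (h * letter_val G11_relations (side_label S z, false) ^+ n) true n xS.
  by rewrite neg_val expVgn mulgK.
- have := off_strip_exp h true n.+1 xS.
  by rewrite neg_val expVgn.
- have := off_strip_exp (h * letter_val G11_relations (side_label S z, false) ^- n.+1)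
    false n.+1 xS.
  by rewrite mulgVK.
Qed.

Lemma strip_edge_rel (u : stable) (i : int) :
  expgz (gval Ga) i * gval (stable_gen u) =
  gval (stable_gen u) * expgz (gval (stable_target u)) i.
Proof.
have conj1 : gval Ga * gval (stable_gen u) =
    gval (stable_gen u) * gval (stable_target u).
  case: u.
  - have := @word_val_rel _ G11_relations
      [:: neg Gs; pos Ga; pos Gs] [:: pos Gc] isT.
    rewrite /word_val !big_cons !big_nil !mulg1 /letter_val /= => E.
    by rewrite -[LHS](mulVKg (gval Gs)) E.
  - have := @word_val_rel _ G11_relations
      [:: neg Gt; pos Ga; pos Gt] [:: pos Gd] isT.
    rewrite /word_val !big_cons !big_nil !mulg1 /letter_val /= => E.
    by rewrite -[LHS](mulVKg (gval Gt)) E.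
have conjn n : gval Ga ^+ n * gval (stable_gen u) =
    gval (stable_gen u) * gval (stable_target u) ^+ n.
  elim: n => [|n IHn]; first by rewrite mul1g mulg1.
  by rewrite expgS -mulgA IHn mulgA conj1 -mulgA -expgS.
case: i => n; first exact: conjn.
by apply: (mulgI (gval Ga ^+ n.+1)); rewrite /= mulVKg mulgA conjn mulgK.
Qed.

Lemma near_side_ex (S : strip) : exists z, near_side S z.
Proof.
have main (w : word gen) (g : G11) :
    g * word_val G11_relations w = strip_base S ->
    exists z i, connected_off (strip_edge S) g (side_point S z false i).
  elim: w g => [|l w IHw] g.
    rewrite /word_val big_nil mulg1 => ->.
    by exists Initial, (Posz 0), [::]; rewrite // /side_point /word_val big_nil.
  rewrite /word_val big_cons mulgA => /IHw [z [i [v Ev Hv]]].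
  case: (pselect (strip_edge S (crossed_edge g l))) => [|El]; last first.
    exists z, i, (l :: v) => //.
    by rewrite /word_val big_cons mulgA.
  case: l {Hv Ev IHw} => x b [/= xE [j]].
  have P0 z' i' : g = side_point S z' false i' -> exists z i,
      connected_off (strip_edge S) g (side_point S z false i).
    by exists z', i', [::]; rewrite // /word_val big_nil mulg1.
  case: b => [Eg|Eg]; last exact: (P0 Initial j).
  apply: (P0 Terminal j); rewrite /side_point /=.
  move: Eg; rewrite /letter_val /= xE => /(canRL (mulgVK _)) ->.
  by rewrite -!mulgA strip_edge_rel.
have [|z [i Hi]] := main (wrepr (strip_base S)) 1.
  by rewrite mul1g word_valE wreprK.
exists z => k; apply: connected_off_trans Hi _.
have [_ back] := side_connected S z i; have [forth _] := side_connected S z k.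
exact: connected_off_trans back forth.
Qed.

Definition side_sequence (S : strip) (z : side) (reversed : bool) (i : int) :
    int :=
  ((word_dist (1%g : G11) (side_point S z reversed (i + 1)%R))%:Z
   - (word_dist (1%g : G11) (side_point S z reversed i))%:Z)%R.

(* (-1)(0,-1)(0)(1,0)(1): the finite part is the word w1 ++ w0 ++ w2 starting
   at index m, and nth returns the default 1 at every later index. *)
Definition has_pattern (q : int -> int) : Prop :=
  exists (m : int) (w1 w0 w2 : seq int),
    [/\ all (mem [:: 0%R; (-1)%R]) w1,
        all (pred1 0%R) w0,
        all (mem [:: 1%R; 0%R]) w2,
        forall i : int, (i < m)%R -> q i = (-1)%R &
        forall k : nat, q (m + k%:Z)%R = nth 1%R (w1 ++ w0 ++ w2) k].

(* Main.v *)
Require Import Defs.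
From mathcomp Require Import all_boot all_order all_algebra.
From HB Require Import structures.
From mathcomp Require Import boolp zify ring.

(** Identify the abelian subgroup A with Z^2 by (x, y) |-> a^x b^y.  Since the
    generators a, b, c, d are the king moves, the metric of a plane is the sup
    norm, and the lines labelled a, c, d have slopes 0, 1, -1; all of them are
    parametrized by x, and a strip glues two such lines so that x is preserved.
    A plane not containing 1 is entered through one strip, along a line
    y = k x.  If f(j) is the distance from 1 to the j-th point of the near side
    of that strip, then the distance from 1 to the point (x, y) of the plane is
        1 + min_j (f(j) + max(|x - j|, |y - k j|)),
    written 1 + [extend k f x y] below.  The near sides of the other strips
    meeting the plane are the lines y = r + k' x, so everything is
    determined by iterating the operation that takes f to the restriction of
    [extend k f] to such a line, starting from the sup norm.

    The slopes of f have the required pattern as soon as f is weakly decreasing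
    and then weakly increasing: f is 1-Lipschitz, and f(j) >= |j| because x
    changes by at most 1 along an edge, which makes the slopes eventually -1 and
    1.  This unimodality is not inherited on its own.  Entering along slope
    0 and leaving along slope 1 gives slopes 1 + f(2i+2) - f(2i) on one side of
    the intersection point, as long as f decreases there, so two-step
    increments of f must be controlled too, then four-step ones, and so on.
    The invariant is [tame]: for every n = 2^k, an increment of f over n steps is
    at most one more than any later increment over n steps.  For n = 1 this
    is unimodality ([almost_convex_valley]).

    Unimodality also turns [extend] into a closed formula ([extend_clip]): the
    minimum is attained at the point, among the parameters of the entry line
    nearest to the given point, which is closest to the bottom M of f.  In this
    way [extend_tame] splits into four cases.  Parallel lines widen the bottom of
    f ([clip_window]); slope 0 to slope 1 or -1 contracts f by 2
    ([clip_halve]); slope 1 or -1 to slope 0 dilates f by 2 ([clip_double] and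
    [clip_double1]); slopes 1 and -1 cross in a convex function.

    To see that these formulas compute the word metric, group elements are
    encoded by the normal form of the HNN extension: the reduced list of strips
    crossed from the plane A, and the coordinates in the last plane.  Letters
    act on these positions and the relations act trivially ([walk_pres_eq]), so
    each element has a position, which determines it ([position_of_inj]).  The
    formula changes by at most 1 along an edge ([origin_dist_act]) and its value
    is realized by a path ([reach_origin_dist]), hence it is the distance to 1
    ([word_distE]).  Finally a path from 1 can reach a plane beyond a strip only
    by crossing that strip ([avoiding_not_beyond]); this identifies the near
    side. *)

Set Implicit Arguments.
Unset Strict Implicit.
Unset Printing Implicit Defensive.

Import Order.TTheory GRing.Theory Num.Theory.

Local Notation word_val_ := (word_val G11_relations).
Local Notation letter_ := (letter_val G11_relations).

(** * Functions on a line *)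

Section Minimum.
Variable h : int -> nat.

Let attained n : bool := `[< exists j, h j = n >].

Let attained_ex : exists n, attained n.
Proof. by exists (h 0%R); apply/asboolP; exists 0%R. Qed.

Definition minval : nat := ex_minn attained_ex.

Lemma minval_ex : exists j, minval = h j.
Proof.
by rewrite /minval; case: ex_minnP => n /asboolP [j <-] _; exists j.
Qed.

Lemma minval_le j : minval <= h j.
Proof.
by rewrite /minval; case: ex_minnP => n _; apply; apply/asboolP; exists j.
Qed.

Lemma argmin_ex : exists M, forall i, h M <= h i.
Proof. by have [M hM] := minval_ex; exists M => i; rewrite -hM minval_le. Qed.

End Minimum.

Definition lipschitz (f : int -> nat) := forall i j : int, f i <= f j + `|i - j|.

(** A convex function satisfies this without the final 1; the slack is what the
    rounding of a convex function to integers costs. *)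
Definition almost_convex (n : nat) (f : int -> nat) :=
  forall i j : int, (i <= j)%R -> f (i + n%:Z)%R + f j <= f i + f (j + n%:Z)%R + 1.

(** Only powers of 2: the transitions between slope 0 and slopes 1, -1 trade
    increments over n steps for increments over 2n steps, and a dilation by 2
    need not respect the bound for odd lengths such as 3. *)
Definition tame f := lipschitz f /\ forall k, almost_convex (2 ^ k) f.

Definition valley (f : int -> nat) (M : int) :=
  (forall i j : int, (i <= j)%R -> (j <= M)%R -> f j <= f i) /\
  (forall i j : int, (M <= i)%R -> (i <= j)%R -> f i <= f j).

Lemma nat_of_le (i j : int) : (i <= j)%R -> exists n : nat, j = (i + n%:Z)%R.
Proof. by move=> ij; exists `|j - i|%N; lia. Qed.

Lemma step_up (f : int -> nat) (i : int) (n : nat) :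
  f i < f (i + n%:Z)%R ->
  exists2 k : int, (i <= k < i + n%:Z)%R & f k < f (k + 1)%R.
Proof.
elim: n => [|n IHn] lt_f; first by rewrite addr0 ltnn in lt_f.
have En : (i + n.+1%:Z = i + n%:Z + 1)%R by lia.
case: (ltnP (f i) (f (i + n%:Z)%R)) => [/IHn [k ? ?]|le_f].
  by exists k => //; lia.
by exists (i + n%:Z)%R; [lia | rewrite -En; exact: leq_ltn_trans lt_f].
Qed.

Lemma step_down (f : int -> nat) (i : int) (n : nat) :
  f (i + n%:Z)%R < f i ->
  exists2 k : int, (i <= k < i + n%:Z)%R & f (k + 1)%R < f k.
Proof.
elim: n => [|n IHn] lt_f; first by rewrite addr0 ltnn in lt_f.
have En : (i + n.+1%:Z = i + n%:Z + 1)%R by lia.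
case: (ltnP (f (i + n%:Z)%R) (f i)) => [/IHn [k ? ?]|le_f].
  by exists k => //; lia.
by exists (i + n%:Z)%R; [lia | rewrite -En; exact: leq_trans le_f].
Qed.

Lemma almost_convex1E f : almost_convex 1 f <->
  forall i j : int, (i <= j)%R -> f (i + 1)%R + f j <= f i + f (j + 1)%R + 1.
Proof. by []. Qed.

(** A step up is never followed by a step down, whereas a failure of
    monotonicity on either side of a global minimum would force such a pair. *)
Lemma almost_convex_valley f : almost_convex 1 f -> exists M, valley f M.
Proof.
move=> /almost_convex1E Qf; have [M minM] := argmin_ex f; exists M.
have no_up_down (i : int) (m : nat) (j : int) (n : nat) :
    f i < f (i + m%:Z)%R -> f (j + n%:Z)%R < f j -> (i + m%:Z <= j)%R -> False.
  move=> /step_up [k k_in up] /step_down [l l_in down] ij.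
  by have := Qf k l; lia.
split=> i j.
- move=> /nat_of_le [m ->] /nat_of_le [n EM].
  rewrite leqNgt; apply/negP => up.
  apply: (no_up_down _ _ (i + m%:Z)%R n up) => //; rewrite -EM.
  exact: leq_ltn_trans (minM i) up.
- move=> /nat_of_le [m ->] /nat_of_le [n ->].
  rewrite leqNgt; apply/negP => down.
  apply: (no_up_down M m (M + m%:Z)%R n) => //.
  exact: leq_ltn_trans (minM _) down.
Qed.

Definition clip (lo hi j : int) : int := Num.max lo (Num.min j hi).

(** The clipped point moves with x but waits at M for q - p steps, so g is f
    with its bottom widened.  An increment of g over n steps is one of f over a
    block of at most n steps; a block shorter than n contains M, and is
    compared with the block of length n that begins or ends at M. *)
Lemma clip_window f n (g : int -> nat) C (M p q : int) :
  (p <= q)%R -> valley f M -> almost_convex n f ->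
  (forall x, g x = C + f (clip (x + p)%R (x + q)%R M)) -> almost_convex n g.
Proof.
move=> pq [dec inc] Qf gE i j ij; rewrite !gE /clip {gE}.
case: (boolP ((i + n%:Z + q) <= M)%R) => ci.
  have -> : Num.max (i + p)%R (Num.min M (i + q)%R) = (i + q)%R by lia.
  have -> : Num.max (i + n%:Z + p)%R (Num.min M (i + n%:Z + q)%R)
            = (i + q + n%:Z)%R by lia.
  case: (boolP ((j + n%:Z + q) <= M)%R) => cj.
    have -> : Num.max (j + p)%R (Num.min M (j + q)%R) = (j + q)%R by lia.
    have -> : Num.max (j + n%:Z + p)%R (Num.min M (j + n%:Z + q)%R)
            = (j + q + n%:Z)%R by lia.
    by have := Qf (i + q)%R (j + q)%R; lia.
  (* The block at j is compared with the one ending at M. *)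
  have := Qf (i + q)%R (M - n%:Z)%R; rewrite subrK => Q1.
  set J := Num.max (j + p)%R _; set K := Num.max _ _.
  have dM : f M <= f K.
    case: (boolP (M <= K)%R) => MK; first exact: inc.
    by apply: dec; lia.
  case: (boolP (J <= M)%R) => JM.
    have := dec (M - n%:Z)%R J; lia.
  have := inc J K; have := dec (i + q)%R (i + q + n%:Z)%R; lia.
case: (boolP (M <= (j + p))%R) => cj.
  have -> : Num.max (j + p)%R (Num.min M (j + q)%R) = (j + p)%R by lia.
  have -> : Num.max (j + n%:Z + p)%R (Num.min M (j + n%:Z + q)%R)
            = (j + p + n%:Z)%R by lia.
  case: (boolP (M <= (i + p))%R) => ci'.
    have -> : Num.max (i + p)%R (Num.min M (i + q)%R) = (i + p)%R by lia.
    have -> : Num.max (i + n%:Z + p)%R (Num.min M (i + n%:Z + q)%R)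
            = (i + p + n%:Z)%R by lia.
    by have := Qf (i + p)%R (j + p)%R; lia.
  set J := Num.max (i + p)%R _; set K := Num.max _ _.
  (* The block at i is compared with the one starting at M. *)
  have := Qf M (j + p)%R cj => Q1.
  have dM : f M <= f J.
    case: (boolP (M <= J)%R) => MK; first exact: inc.
    by apply: dec; lia.
  case: (boolP (M <= K)%R) => JM.
    have := inc K (M + n%:Z)%R; lia.
  lia.
(* Both blocks contain M, and monotonicity on its two sides suffices. *)
set Ji := Num.max (i + p)%R _; set Ki := Num.max (i + n%:Z + p)%R _.
set Jj := Num.max (j + p)%R _; set Kj := Num.max (j + n%:Z + p)%R _.
have := dec Ji Jj; have := inc Ki Kj; lia.
Qed.

(** To the left of x0 the function is replaced by its steepest
    1-Lipschitz continuation, of slope -1. *)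
Lemma steep_left_almost_convex f n (x0 : int) :
  lipschitz f -> almost_convex n f ->
  almost_convex n (fun y => f (Num.max x0 y) + `|Num.max x0 y - y|).
Proof.
move=> lip Qf i j ij.
case: (boolP (x0 <= i)%R) => i0.
  have [-> -> -> ->] : [/\ Num.max x0 i = i, Num.max x0 j = j,
      Num.max x0 (i + n%:Z)%R = (i + n%:Z)%R &
      Num.max x0 (j + n%:Z)%R = (j + n%:Z)%R] by split; lia.
  by have := Qf i j; lia.
have -> : Num.max x0 i = x0 by lia.
case: (boolP (x0 <= j)%R) => j0.
  have [-> ->] : Num.max x0 j = j /\
      Num.max x0 (j + n%:Z)%R = (j + n%:Z)%R by lia.
  have := Qf i j ij; case: (boolP (x0 <= (i + n%:Z))%R) => in0.
    have -> : Num.max x0 (i + n%:Z)%R = (i + n%:Z)%R by lia.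
    have := lip i x0; lia.
  have -> : Num.max x0 (i + n%:Z)%R = x0 by lia.
  have := lip j (j + n%:Z)%R; lia.
have -> : Num.max x0 j = x0 by lia.
by have := lip (Num.max x0 (i + n%:Z)%R) (Num.max x0 (j + n%:Z)%R); lia.
Qed.

(** A block of length n that is cut at M decreases at most as much as the
    block of length n that ends at M. *)
Lemma truncated_almost_convex f n (M : int) :
  valley f M -> almost_convex n f ->
  almost_convex n (fun y => f (Num.min M y)).
Proof.
move=> [dec inc] Qf i j ij.
case: (boolP ((j + n%:Z) <= M)%R) => jM.
  have [-> -> -> ->] : [/\ Num.min M i = i, Num.min M j = j,
      Num.min M (i + n%:Z)%R = (i + n%:Z)%R &
      Num.min M (j + n%:Z)%R = (j + n%:Z)%R] by split; lia.
  exact: Qf.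
have -> : Num.min M (j + n%:Z)%R = M by lia.
have : f (Num.min M j) <= f (Num.min M i) by apply: dec; lia.
case: (boolP (M <= (i + n%:Z))%R) => iM.
  have -> : Num.min M (i + n%:Z)%R = M by lia.
  lia.
have := Qf i (M - n%:Z)%R; rewrite subrK => Q1.
have : f (Num.min M j) <= f (M - n%:Z)%R by apply: dec; lia.
have -> : Num.min M i = i by lia.
have -> : Num.min M (i + n%:Z)%R = (i + n%:Z)%R by lia.
lia.
Qed.

Lemma reflect_almost_convex f n (r : int) :
  almost_convex n f -> almost_convex n (fun x => f (r - x)%R).
Proof.
move=> Qf i j ij.
have := Qf (r - j - n%:Z)%R (r - i - n%:Z)%R.
have E x : (r - (x + n%:Z) = r - x - n%:Z)%R by lia.
by rewrite !subrK !E; lia.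
Qed.

Lemma reflect_valley f (M r : int) :
  valley f M -> valley (fun x => f (r - x)%R) (r - M)%R.
Proof.
by move=> [dec inc]; split=> i j ? ?; [apply: inc | apply: dec]; lia.
Qed.

Lemma reflect_lipschitz f (r : int) :
  lipschitz f -> lipschitz (fun x => f (r - x)%R).
Proof. by move=> lip i j; have := lip (r - i)%R (r - j)%R; lia. Qed.

(** Up to the linear term x - x0, g x is the value at 2 x - x0 of f made steep to
    the left of x0 and truncated at M; so an increment of g over n steps is one
    of a modification of f over 2n steps. *)
Lemma halve_right f n (g : int -> nat) (M x0 : int) :
  lipschitz f -> valley f M -> almost_convex (n + n) f -> (x0 <= M)%R ->
  (forall x, g x = `|x - x0| + f (Num.max x0 (Num.min M (2 * x - x0)%R))) ->
  almost_convex n g.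
Proof.
move=> lip [dec inc] Qf Mx0 gE.
have val1 : valley (fun y => f (Num.max x0 y) + `|Num.max x0 y - y|) M.
  split=> i j ? ?.
    have := dec (Num.max x0 i) (Num.max x0 j); lia.
  have := inc (Num.max x0 i) (Num.max x0 j); lia.
have := truncated_almost_convex val1 (steep_left_almost_convex x0 lip Qf).
set f2 := fun y : int => _ => Qf2 i j ij.
have gE2 x : ((g x)%:Z = x - x0 + (f2 (2 * x - x0)%R)%:Z)%R.
  rewrite gE /f2; case: (boolP (x0 <= x)%R) => cx.
    have -> : Num.max x0 (Num.min M (2 * x - x0)%R) = Num.min M (2 * x - x0)%R.
      lia.
    lia.
  have -> : Num.min M (2 * x - x0)%R = (2 * x - x0)%R by lia.
  have -> : Num.max x0 (2 * x - x0)%R = x0 by lia.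
  lia.
clearbody f2.
have := Qf2 (2 * i - x0)%R (2 * j - x0)%R.
have E (x : int) : (2 * x - x0 + (n + n)%N%:Z = 2 * (x + n%:Z) - x0)%R by lia.
rewrite !E.
have := gE2 i; have := gE2 j; have := gE2 (i + n%:Z)%R; have := gE2 (j + n%:Z)%R.
lia.
Qed.

(** The window runs from x0 to its mirror image in x.  The two positions of the
    bottom M with respect to x0 are exchanged by a reflection. *)
Lemma clip_halve f n (g : int -> nat) (M x0 : int) :
  lipschitz f -> valley f M -> almost_convex (n + n) f ->
  (forall x, g x = `|x - x0| +
    f (clip (Num.min x0 (2 * x - x0)%R) (Num.max x0 (2 * x - x0)%R) M)) ->
  almost_convex n g.
Proof.
move=> lip val Qf gE; case: (boolP (x0 <= M)%R) => cM.
  apply: (halve_right lip val Qf cM) => x; rewrite gE /clip.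
  by congr (_ + f _); lia.
have -> : g = fun x => g (0 - (0 - x))%R by apply/funext => x; congr g; lia.
apply: (@reflect_almost_convex (fun x => g (0 - x)%R)).
apply: (halve_right (reflect_lipschitz 0%R lip) (reflect_valley 0%R val)
          (reflect_almost_convex 0%R Qf) (x0 := - x0)%R); first lia.
by move=> x; rewrite gE /clip; congr (_ + f _); lia.
Qed.

(** The dilation of f by 2: odd arguments stand for half-integers, where the
    smaller neighbouring value is taken. *)
Definition half_rescaled (f h : int -> nat) := forall k : int,
  h (2 * k)%R = f k /\ h (2 * k + 1)%R = minn (f k) (f (k + 1)%R).

(** Whichever neighbour realizes the minimum at a half-integer on the larger
    side of the inequality, the corresponding choice on the smaller side reduces
    the claim to one for f over n steps. *)
Lemma half_rescaled_almost_convex f h n :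
  half_rescaled f h -> almost_convex n f -> almost_convex (n + n) h.
Proof.
move=> hE Qf i j; rewrite le_eqVlt => /orP [/eqP ->|ij]; first lia.
have E0 (k : int) : (2 * k + (n + n)%N%:Z = 2 * (k + n%:Z))%R by lia.
have E1 (k : int) : (2 * k + 1 + (n + n)%N%:Z = 2 * (k + n%:Z) + 1)%R by lia.
have parity (x : int) : exists k : int, (x = 2 * k \/ x = 2 * k + 1)%R.
  by exists (x %/ 2)%Z; lia.
have [k Hk] := parity i; have [l Hl] := parity j.
have [hk hk1] := hE k; have [hl hl1] := hE l.
have [hkn hkn1] := hE (k + n%:Z)%R; have [hln hln1] := hE (l + n%:Z)%R.
have Qkl := Qf k l; have Qkl1 := Qf k (l + 1)%R; have Qk1l := Qf (k + 1)%R l.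
have Qk1l1 := Qf (k + 1)%R (l + 1)%R.
have C (x : int) : (x + n%:Z + 1 = x + 1 + n%:Z)%R by lia.
rewrite !C in hkn1 hln1.
case: Hk ij => ->; case: Hl => -> ij; rewrite ?E1 ?E0.
- by rewrite hk hl hkn hln; apply: Qkl; lia.
- by rewrite hk hl1 hkn hln1; lia.
- by rewrite hk1 hl hkn1 hln; lia.
- by rewrite hk1 hl1 hkn1 hln1; lia.
Qed.

Lemma clip_half_rescaled f (M : int) :
  valley f M -> half_rescaled f (fun y => f (clip (y %/ 2)%Z ((y + 1) %/ 2)%Z M)).
Proof.
move=> [dec inc] k.
have -> : (2 * k %/ 2)%Z = k by lia.
have -> : ((2 * k + 1) %/ 2)%Z = k by lia.
have -> : ((2 * k + 1 + 1) %/ 2)%Z = (k + 1)%R by lia.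
have -> : clip k k M = k by rewrite /clip; lia.
split=> //; case: (boolP (k + 1 <= M)%R) => kM.
  have -> : clip k (k + 1)%R M = (k + 1)%R by rewrite /clip; lia.
  have := dec k (k + 1)%R; lia.
have -> : clip k (k + 1)%R M = k by rewrite /clip; lia.
have := inc k (k + 1)%R; lia.
Qed.

(** The added term [uphalf `|x - x0|] has nondecreasing increments over any even
    number of steps, so it preserves the bound. *)
Lemma clip_double f n (g : int -> nat) (M x0 : int) :
  valley f M -> almost_convex n f ->
  (forall x, g x = uphalf `|x - x0|
     + f (clip ((x + x0) %/ 2)%Z ((x + x0 + 1) %/ 2)%Z M)) ->
  almost_convex (n + n) g.
Proof.
move=> val Qf gE i j ij; rewrite !gE.
have := half_rescaled_almost_convex (clip_half_rescaled val) Qf.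
set h := fun y : int => _ => Qh.
rewrite -!/(h _).
have := Qh (i + x0)%R (j + x0)%R.
have E (x : int) : (x + x0 + (n + n)%N%:Z = x + (n + n)%N%:Z + x0)%R by lia.
rewrite !E; clearbody h; lia.
Qed.

(** Over a single step the added term is not convex: its slopes alternate between
    1 and 0 to the right of x0.  But they are 1 exactly where the dilated f may
    decrease, so that g increases weakly to the right of x0, and symmetrically on
    the left. *)
Lemma clip_double1 f (g : int -> nat) (M x0 : int) :
  lipschitz f -> valley f M -> 
  (forall x, g x = uphalf `|x - x0|
     + f (clip ((x + x0) %/ 2)%Z ((x + x0 + 1) %/ 2)%Z M)) ->
  almost_convex 1 g.
Proof.
move=> lip val gE.
have := clip_half_rescaled val.
move: gE; set h := fun y : int => f (clip (y %/ 2)%Z _ _) => gE hE.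
have {}gE x : g x = uphalf `|x - x0| + h (x + x0)%R by rewrite gE.
clearbody h.
have slope (x : int) : if (x0 <= x)%R then g x <= g (x + 1)%R <= g x + 1
                       else g (x + 1)%R <= g x <= g (x + 1)%R + 1.
  rewrite !gE; set k := ((x + x0) %/ 2)%Z.
  have [hk hk1] := hE k; have [hk2 _] := hE (k + 1)%R.
  have := lip k (k + 1)%R; have := lip (k + 1)%R k.
  have [Ex|Ex] : (x + x0 = 2 * k \/ x + x0 = 2 * k + 1)%R by rewrite /k; lia.
    have -> : (x + 1 + x0 = 2 * k + 1)%R by lia.
    by rewrite Ex hk hk1; case: ifP => ?; lia.
  have -> : (x + 1 + x0 = 2 * (k + 1))%R by lia.
  by rewrite Ex hk1 hk2; case: ifP => ?; lia.
apply/almost_convex1E => i j ij.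
by have := slope i; have := slope j; case: ifP => ?; case: ifP => ?; lia.
Qed.

(** * Distances in a plane *)

Lemma minval_eq h n : (exists j, h j = n) -> (forall j, n <= h j) -> minval h = n.
Proof.
move=> [j <-] le_h; apply/eqP; rewrite eqn_leq minval_le.
by have [i ->] := minval_ex h; rewrite le_h.
Qed.

(** The distance from a line y = k x carrying initial distances f: the
    inf-convolution of f with the sup norm. *)
Definition extend (k : int) (f : int -> nat) (x y : int) : nat :=
  minval (fun j => f j + maxn `|x - j| `|(y - k * j)%R|).

Lemma extend_le k f x y j : extend k f x y <= f j + maxn `|x - j| `|(y - k * j)%R|.
Proof. exact: minval_le. Qed.

Lemma extend_ex k f x y :
  exists j, extend k f x y = f j + maxn `|x - j| `|(y - k * j)%R|.
Proof. exact: minval_ex. Qed.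

Lemma extend_lipschitz k f (x y x' y' : int) :
  extend k f x y <= extend k f x' y' + maxn `|x - x'| `|y - y'|.
Proof.
have [j ->] := extend_ex k f x' y'.
have := extend_le k f x y j; lia.
Qed.

Lemma extend_line k f (x : int) :
  lipschitz f -> extend k f x (k * x)%R = f x.
Proof.
move=> lip; apply: minval_eq; first by exists x; lia.
by move=> j; have := lip x j; lia.
Qed.

Lemma lipschitz_on_line (F : int -> int -> nat) (r k : int) :
  `|k| <= 1 ->
  (forall x y x' y' : int, F x y <= F x' y' + maxn `|x - x'| `|y - y'|) ->
  lipschitz (fun j => F j (r + k * j)%R).
Proof.
move=> k1 lipF i j; have := lipF i (r + k * i)%R j (r + k * j)%R.
have [->|[->|->]] : k = 0%R \/ k = 1%R \/ k = (- 1)%R by lia.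
- lia.
- lia.
- lia.
Qed.

(** The hypothesis says that the points of the entry line nearest to (x, y) are
    those with parameter in [lo, hi], at distance W, and that the distance then
    grows with slope 1.  As f is 1-Lipschitz, nothing is gained by leaving that
    window, and within it f is least at the point closest to its bottom. *)
Lemma extend_clip k f (M x y : int) W (lo hi : int) :
  lipschitz f -> valley f M -> (lo <= hi)%R ->
  (forall j : int, maxn `|x - j| `|(y - k * j)%R| = W + `|j - clip lo hi j|) ->
  extend k f x y = W + f (clip lo hi M).
Proof.
move=> lip [dec inc] lohi NE; apply: minval_eq.
  exists (clip lo hi M); rewrite NE /clip; lia.
move=> j; rewrite NE.
have := lip (clip lo hi j) j.
suff: f (clip lo hi M) <= f (clip lo hi j) by lia.
case: (boolP (clip lo hi j <= clip lo hi M)%R) => c.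
  case: (boolP (clip lo hi M <= M)%R) => c'; first exact: dec.
  have -> : clip lo hi j = clip lo hi M by move: c c'; rewrite /clip; lia.
  by [].
case: (boolP (M <= clip lo hi M)%R) => c'; first by apply: inc; lia.
have -> : clip lo hi j = clip lo hi M by move: c c'; rewrite /clip; lia.
by [].
Qed.

Section Lines.
Variables (f : int -> nat) (M e r x : int).
Hypotheses (lip : lipschitz f) (val : valley f M) (e1 : `|e| = 1).

Lemma extend_horizontal_parallel :
  extend 0 f x r = `|r| + f (clip (x + - `|r|%:Z)%R (x + `|r|%:Z)%R M).
Proof.
by apply: extend_clip => //; [|move=> j; rewrite /clip]; clear -r x; lia.
Qed.

Lemma extend_diagonal_parallel :
  extend e f x (r + e * x)%R = uphalf `|r| +
  f (clip (x + ((e * r) %/ 2)%Z)%R (x + ((e * r + 1) %/ 2)%Z)%R M).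
Proof.
apply: extend_clip => //; first by clear; lia.
have [->|->] : e = 1%R \/ e = (- 1)%R by lia.
  by move=> j; rewrite /clip; clear; lia.
by move=> j; rewrite /clip; clear; lia.
Qed.

Lemma extend_horizontal_diagonal :
  extend 0 f x (r + e * x)%R = `|(x - - e * r)%R| +
  f (clip (Num.min (- e * r) (2 * x - - e * r))%R
          (Num.max (- e * r) (2 * x - - e * r))%R M).
Proof.
apply: extend_clip => //; first by clear; lia.
have [->|->] : e = 1%R \/ e = (- 1)%R by lia.
  by move=> j; rewrite /clip; clear; lia.
by move=> j; rewrite /clip; clear; lia.
Qed.

Lemma extend_diagonal_horizontal :
  extend e f x r = uphalf `|(x - e * r)%R| +
  f (clip ((x + e * r) %/ 2)%Z ((x + e * r + 1) %/ 2)%Z M).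
Proof.
apply: extend_clip => //; first by clear; lia.
have [->|->] : e = 1%R \/ e = (- 1)%R by lia.
  by move=> j; rewrite /clip; clear; lia.
by move=> j; rewrite /clip; clear; lia.
Qed.

(** The window does not depend on x, which leaves the distance from x to e r / 2,
    rounded up, plus a constant. *)
Lemma extend_diagonals_cross :
  extend e f x (r - e * x)%R = uphalf `|(2 * x - e * r)%R| +
  f (clip ((e * r) %/ 2)%Z ((e * r + 1) %/ 2)%Z M).
Proof.
apply: extend_clip => //; first by clear; lia.
have [->|->] : e = 1%R \/ e = (- 1)%R by lia.
  by move=> j; rewrite /clip; clear; lia.
by move=> j; rewrite /clip; clear; lia.
Qed.

End Lines.

Lemma extend_tame k k' r f : `|k| <= 1 -> `|k'| <= 1 ->
  tame f -> tame (fun j => extend k f j (r + k' * j)%R).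
Proof.
move=> k1 k1' [lip Qf]; split.
  by apply: (lipschitz_on_line (F := extend k f)) => //; exact: extend_lipschitz.
have [M val] := almost_convex_valley (Qf 0).
have [k0|nk0] := eqVneq k 0%R; have [k0'|nk0'] := eqVneq k' 0%R.
- move=> m; apply: (clip_window _ val (Qf m)) => [|x]; last first.
    by rewrite k0 k0' mul0r addr0; exact: extend_horizontal_parallel.
  by clear; lia.
- have e1 : `|k'| = 1 by lia.
  have Q2f m : almost_convex (2 ^ m + 2 ^ m) f.
    by rewrite addnn -mul2n -expnS.
  move=> m; apply: (clip_halve lip val (Q2f m)) => x.
  by rewrite k0; exact: extend_horizontal_diagonal.
- have e1 : `|k| = 1 by lia.
  have gE x : extend k f x (r + k' * x)%R = uphalf `|(x - k * r)%R| +
      f (clip ((x + k * r) %/ 2)%Z ((x + k * r + 1) %/ 2)%Z M).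
    by rewrite k0' mul0r addr0; exact: extend_diagonal_horizontal.
  case=> [|m]; first exact: clip_double1 lip val gE.
  by rewrite expnS mul2n -addnn; exact: clip_double val (Qf m) gE.
have e1 : `|k| = 1 by lia.
have [->|->] : k' = k \/ k' = (- k)%R by lia.
  move=> m; apply: (clip_window _ val (Qf m)) => [|x]; last first.
    exact: extend_diagonal_parallel.
  by clear; lia.
move=> m i j ij; rewrite !mulNr !(extend_diagonals_cross _ _ lip val) //.
by move: (f _) (2 ^ m) ij => c n; clear; lia.
Qed.

Lemma sup_norm_tame (r k : int) : `|k| <= 1 -> tame (fun j => maxn `|j| `|(r + k * j)%R|).
Proof.
move=> k1; split.
  by apply: (lipschitz_on_line (F := fun x y => maxn `|x| `|y|)) => //; lia.
move=> m i j ij.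
have [->|[->|->]] : k = 0%R \/ k = 1%R \/ k = (- 1)%R by lia.
- lia.
- lia.
- lia.
Qed.

(** * Positions: planes, and coordinates in a plane *)

(** The pair (r, l) stands for the crossing by the letter l of the strip whose
    near side is the line y = r + [slope l] * x of the current plane. *)
Definition crossing : Type := int * letter gen.

(** The most recent crossing comes first in [route]; the coordinates are those of
    the last plane, normalized so that its entry line passes through (0, 0). *)
Record position := Position { route : seq crossing; xpos : int; ypos : int }.

(** The slope of the line from which the letter l leaves; the line on which it
    arrives has slope [slope (linv l)].  Forward stable letters leave from
    a-lines; s^-1 leaves from a c-line and t^-1 from a d-line. *)
Definition slope (l : letter gen) : int :=
  match l with (Gs, true) => 1%R | (Gt, true) => (- 1)%R | _ => 0%R end.

(** The crossing goes back through the entry line of the current plane. *)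
Definition returns (s : position) (l : letter gen) : bool :=
  if route s is (_, l') :: _ then
    (ypos s == slope l * xpos s)%R && (l' == linv l)
  else false.

Arguments slope : simpl never.
Arguments linv : simpl never.

Definition cross (l : letter gen) (s : position) : position :=
  let: Position p x y := s in
  if returns s l then
    Position (behead p) x ((head (0%R, l) p).1 + slope (linv l) * x)%R
  else Position ((y - slope l * x, l)%R :: p) x (slope (linv l) * x)%R.

Definition shift (dx dy : int) (s : position) : position :=
  Position (route s) (xpos s + dx)%R (ypos s + dy)%R.

Definition act (l : letter gen) (s : position) : position :=
  let e : int := if l.2 then (- 1)%R else 1%R in
  match l.1 with
  | Ga => shift e 0%R s
  | Gb => shift 0%R e s
  | Gc => shift e e s
  | Gd => shift e (- e)%R s
  | _ => cross l s
  end.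

Definition walk (w : word gen) (s : position) : position :=
  foldl (fun s l => act l s) s w.

Lemma walk_cat u v s : walk (u ++ v) s = walk v (walk u s).
Proof. exact: foldl_cat. Qed.

Definition stable_letter (l : letter gen) : bool := l.1 \in [:: Gs; Gt].

Fixpoint reduced (p : seq crossing) : bool :=
  if p is (r, l) :: p' then
    [&& stable_letter l, reduced p'
      & if p' is (_, l') :: _ then ~~ ((r == 0%R) && (l' == linv l)) else true]
  else true.

Lemma gen_linvK : involutive (@linv gen). Proof. exact: linvK. Qed.

Lemma cross_reduced l s :
  stable_letter l -> reduced (route s) -> reduced (route (cross l s)).
Proof.
case: s => p x y Hl /= red; case: ifP => [|/negP nret] /=.
  by case: p red => [//|[r l'] p] /= /and3P [].
rewrite Hl red /=; case: p red nret => // -[r l'] p _ /= nret.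
by rewrite subr_eq0; apply/negP.
Qed.

Lemma act_reduced l s : reduced (route s) -> reduced (route (act l s)).
Proof.
case: s => p x y; case: l => -[] b //= red;
exact: (cross_reduced (s := Position p x y)).
Qed.

Lemma walk_reduced w s : reduced (route s) -> reduced (route (walk w s)).
Proof. by elim: w s => //= l w IHw s red; apply/IHw/act_reduced. Qed.

Lemma cross_push l p x y : ~~ returns (Position p x y) l ->
  cross l (Position p x y) =
  Position ((y - slope l * x, l)%R :: p) x (slope (linv l) * x)%R.
Proof. by rewrite /cross => /negPf ->. Qed.

Lemma cross_pop l r p x :
  cross l (Position ((r, linv l) :: p) x (slope l * x)%R) =
  Position p x (r + slope (linv l) * x)%R.
Proof. by rewrite /cross /returns /= !eqxx. Qed.

Lemma returnsP l p x y : returns (Position p x y) l ->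
  exists r p', p = (r, linv l) :: p' /\ y = (slope l * x)%R.
Proof.
case: p => [//|[r l'] p]; rewrite /returns /= => /andP [/eqP -> /eqP ->].
by exists r, p.
Qed.

Lemma reduced_not_returns l r p x (y : int) :
  reduced ((r, l) :: p) -> y = (r + slope l * x)%R ->
  ~~ returns (Position p x y) l.
Proof.
case: p => [//|[r' l'] p] /= /and3P [_ _ nback] ->.
apply: contra nback; rewrite /returns /= => /andP [/eqP r0 ->].
by rewrite andbT -(addrK (slope l * x)%R r) r0 subrr.
Qed.

Arguments cross : simpl never.

(** The case t = 0 says that l and its inverse cancel, the case t = 1 gives the
    two conjugation relations. *)
Lemma cross_shift l s (t : int) : stable_letter l -> reduced (route s) ->
  cross (linv l) (shift t (slope (linv l) * t)%R (cross l s)) =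
  shift t (slope l * t)%R s.
Proof.
case: s => p x y Hl /= red.
case: (boolP (returns (Position p x y) l)) => [|nret].
  move/returnsP=> [r [p' [Ep ->]]]; move: red; rewrite Ep => red.
  rewrite cross_pop /shift /= cross_push.
    by rewrite gen_linvK; congr (Position ((_, _) :: _) _ _); ring.
  by apply: (reduced_not_returns red); ring.
rewrite cross_push // /shift /= -mulrDr.
have := cross_pop (linv l); rewrite gen_linvK => ->.
by congr Position; ring.
Qed.

Lemma shift0 s : shift 0 0 s = s.
Proof. by case: s => p x y; rewrite /shift /= !addr0. Qed.

Lemma act_linv l s : reduced (route s) -> act (linv l) (act l s) = s.
Proof.
move=> red; have cr (l' : letter gen) : stable_letter l' ->
    cross (linv l') (cross l' s) = s.
  move=> Hl; have := cross_shift 0%R Hl red.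
  by rewrite !mulr0 !shift0.
case: l => -[] b; rewrite /act /=; try exact: (cr (_, _));
by case: b; case: s {red cr} => p x y; rewrite /shift /=; congr Position; ring.
Qed.

Lemma walk_rel u v s : reduced (route s) -> (u, v) \in G11_relations ->
  walk u s = walk v s.
Proof.
move=> red; rewrite /G11_relations !inE.
case/or4P => [|||/orP []] /eqP [-> ->] /=; rewrite /act /=.
- by case: s red => p x y _; rewrite /shift /=; congr Position; ring.
- by case: s red => p x y _; rewrite /shift /=; congr Position; ring.
- by case: s red => p x y _; rewrite /shift /=; congr Position; ring.
- have := cross_shift (l := neg Gs) 1%R isT red; rewrite /slope /linv /= mul0r => ->.
  by rewrite mul1r.
- have := cross_shift (l := neg Gt) 1%R isT red; rewrite /slope /linv /= mul0r => ->.
  by rewrite mulr1.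
Qed.

Lemma walk_pres_eq u v : pres_eq G11_relations u v ->
  forall s, reduced (route s) -> walk u s = walk v s.
Proof.
elim=> {u v}.
- by [].
- by move=> u v _ IH s red; rewrite IH.
- by move=> u v w _ IHu _ IHv s red; rewrite IHu ?IHv.
- move=> u u' v v' _ IHu _ IHv s red.
  by rewrite !walk_cat IHu // IHv // walk_reduced.
- by move=> l s red /=; apply: act_linv.
- by move=> u v uv s red; apply: walk_rel.
Qed.

Definition origin := Position [::] 0%R 0%R.

Definition position_of (g : G11) : position := walk (wrepr g) origin.

Lemma position_of_word w : position_of (word_val_ w) = walk w origin.
Proof. by apply: walk_pres_eq => //; rewrite word_valE; exact: wrepr_class. Qed.

Lemma position_of1 : position_of 1%g = origin.
Proof. by have := position_of_word [::]; rewrite /word_val big_nil. Qed.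

Lemma position_of_reduced g : reduced (route (position_of g)).
Proof. exact: walk_reduced. Qed.

Lemma word_val_wrepr (g : G11) : g = word_val_ (wrepr g).
Proof. by rewrite word_valE wreprK. Qed.

Lemma position_of_mul g w : position_of (g * word_val_ w)%g = walk w (position_of g).
Proof.
have -> : (g * word_val_ w)%g = word_val_ (wrepr g ++ w).
  by rewrite {1}(word_val_wrepr g) /word_val big_cat.
by rewrite position_of_word walk_cat.
Qed.

Lemma position_of_letter g l :
  position_of (g * letter_ l)%g = act l (position_of g).
Proof. by have := position_of_mul g [:: l]; rewrite /word_val big_seq1. Qed.

(** * A position determines its group element *)

Lemma letter_pos x : letter_ (x, false) = gval x. Proof. by []. Qed.

Lemma letter_neg x : letter_ (x, true) = ((gval x)^-1)%g. Proof. by []. Qed.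

Lemma int_step_ind (P : int -> Prop) :
  P 0%R -> (forall i : int, P i -> P (i + 1)%R) ->
  (forall i : int, P i -> P (i - 1)%R) -> forall i, P i.
Proof.
move=> P0 Pp Pm; case; elim=> [|n IHn] //.
- by have := Pp _ IHn; congr P; lia.
- by have := Pm _ P0; congr P; lia.
- by have := Pm _ IHn; congr P; lia.
Qed.

Lemma expgz_succ (G : groupType) (x : G) (i : int) :
  expgz x (i + 1)%R = (expgz x i * x)%g.
Proof.
case: i => n.
  have -> : (Posz n + 1 = Posz n.+1)%R by lia.
  by rewrite /= expgSr.
case: n => [|n]; first by rewrite /= expg1 mulVg.
have -> : (Negz n.+1 + 1 = Negz n)%R by lia.
by rewrite /= [(x ^+ n.+2)%g]expgS invgM mulgVK.
Qed.

Lemma expgz_pred (G : groupType) (x : G) (i : int) :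
  expgz x (i - 1)%R = (expgz x i * x^-1)%g.
Proof. by rewrite -{2}(subrK 1%R i) expgz_succ mulgK. Qed.

Lemma expgz_commute (G : groupType) (x y : G) (i : int) :
  (x * y = y * x -> expgz x i * y = y * expgz x i)%g.
Proof.
move=> xy; elim/int_step_ind: i => [|i IHi|i IHi]; first by rewrite /= mul1g mulg1.
- by rewrite expgz_succ -mulgA xy !mulgA IHi.
- rewrite expgz_pred -mulgA.
  have -> : (x^-1 * y = y * x^-1)%g by rewrite -{1}(mulgK x y) -xy !mulgA mulVg mul1g.
  by rewrite !mulgA IHi.
Qed.

(** Locked, since otherwise associativity would be rewritten inside it. *)
HB.lock Definition plane_val (x y : int) : G11 :=
  (expgz (gval Ga) x * expgz (gval Gb) y)%g.

Lemma gval_ab : (gval Ga * gval Gb = gval Gb * gval Ga)%g.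
Proof.
have := @word_val_rel _ G11_relations [:: pos Ga; pos Gb] [:: pos Gb; pos Ga] isT.
by rewrite /word_val !big_cons !big_nil !mulg1.
Qed.

Lemma gval_c : gval Gc = (gval Ga * gval Gb)%g.
Proof.
have := @word_val_rel _ G11_relations [:: pos Gc] [:: pos Ga; pos Gb] isT.
by rewrite /word_val !big_cons !big_nil !mulg1.
Qed.

Lemma gval_d : gval Gd = (gval Ga * (gval Gb)^-1)%g.
Proof.
have := @word_val_rel _ G11_relations [:: pos Gd] [:: pos Ga; neg Gb] isT.
by rewrite /word_val !big_cons !big_nil !mulg1.
Qed.

Lemma plane_val_b x y : (plane_val x y * gval Gb = plane_val x (y + 1)%R)%g.
Proof. by rewrite plane_val.unlock expgz_succ mulgA. Qed.

Lemma plane_val_bV x y : (plane_val x y * (gval Gb)^-1 = plane_val x (y - 1)%R)%g.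
Proof. by rewrite plane_val.unlock expgz_pred mulgA. Qed.

Lemma plane_val_a x y : (plane_val x y * gval Ga = plane_val (x + 1)%R y)%g.
Proof.
by rewrite plane_val.unlock expgz_succ -!mulgA (expgz_commute _ (esym gval_ab)).
Qed.

Lemma plane_val_aV x y : (plane_val x y * (gval Ga)^-1 = plane_val (x - 1)%R y)%g.
Proof. by rewrite -{1}(subrK 1%R x) -plane_val_a mulgK. Qed.

Lemma plane_val_target u i :
  expgz (gval (stable_target u)) i = plane_val i (slope (stable_gen u, true) * i)%R.
Proof.
elim/int_step_ind: i => [|i IHi|i IHi].
- by rewrite mulr0 plane_val.unlock /= mul1g.
- rewrite expgz_succ IHi; case: {IHi} u => /=; rewrite ?gval_c ?gval_d !mulgA plane_val_a
    ?plane_val_b ?plane_val_bV; congr plane_val; rewrite /slope /=; lia.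
- rewrite expgz_pred IHi; case: {IHi} u => /=.
    rewrite gval_c gval_ab invgM !mulgA plane_val_aV plane_val_bV.
    congr plane_val; rewrite /slope /=; lia.
  have -> : gval Gd = ((gval Gb)^-1 * gval Ga)%g.
    by rewrite gval_d -{2}(mulgK (gval Gb) (gval Ga)) gval_ab !mulgA mulVg mul1g.
  rewrite invgM invgK !mulgA plane_val_aV plane_val_b.
  congr plane_val; rewrite /slope /=; lia.
Qed.

(** Moving along one side of a strip and crossing it is crossing it and moving
    equally far along the other side. *)
Lemma plane_val_stable l x : stable_letter l ->
  (plane_val x (slope l * x)%R * letter_ l =
   letter_ l * plane_val x (slope (linv l) * x)%R)%g.
Proof.
move=> Hl; have [u [b ->]] : exists u b, l = (stable_gen u, b).
  by case: l Hl => -[] b // _; [exists St_s, b | exists St_t, b].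
have E0 : plane_val x 0 = expgz (gval Ga) x by rewrite plane_val.unlock /= mulg1.
have s0 : slope (stable_gen u, false) = 0%R by case: u.
have := strip_edge_rel u x; rewrite plane_val_target -E0 => E.
case: b; rewrite ?letter_neg ?letter_pos /linv /= s0 mul0r.
  by apply: (mulgI (gval (stable_gen u))); rewrite !mulgA -E mulgV mul1g mulgK.
exact: E.
Qed.

Fixpoint route_val (p : seq crossing) : G11 :=
  if p is (r, l) :: p' then
    (route_val p' * plane_val 0 r * letter_ l)%g
  else 1%g.

Definition position_val (s : position) : G11 :=
  (route_val (route s) * plane_val (xpos s) (ypos s))%g.

Lemma plane_valD (x y x' y' : int) :
  (plane_val x y * plane_val x' y' = plane_val (x + x')%R (y + y')%R)%g.
Proof.
elim/int_step_ind: x' x y => [|i IHi|i IHi] x y.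
- rewrite addr0; elim/int_step_ind: y' y => [|i IHi|i IHi] y.
  + by rewrite addr0 plane_val.unlock !mulg1.
  + by rewrite -plane_val_b mulgA IHi plane_val_b; congr plane_val; lia.
  + by rewrite -plane_val_bV mulgA IHi plane_val_bV; congr plane_val; lia.
- by rewrite -plane_val_a mulgA IHi plane_val_a; congr plane_val; lia.
- by rewrite -plane_val_aV mulgA IHi plane_val_aV; congr plane_val; lia.
Qed.

Lemma letter_linv l : letter_ (linv l) = ((letter_ l)^-1)%g.
Proof. by case: l => x [] //; rewrite /letter_val /= invgK. Qed.

Lemma position_val_cross l s : stable_letter l ->
  position_val (cross l s) = (position_val s * letter_ l)%g.
Proof.
case: s => p x y Hl.
case: (boolP (returns (Position p x y) l)) => [/returnsP [r [p' [-> ->]]]|nret].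
  rewrite cross_pop /position_val /= -[RHS]mulgA plane_val_stable //.
  by rewrite letter_linv !mulgA mulgVK -mulgA plane_valD add0r.
rewrite cross_push // /position_val /= -!mulgA -plane_val_stable // !mulgA.
by rewrite -[(route_val p * _ * _)%g]mulgA plane_valD add0r subrK.
Qed.

Lemma position_val_act l s :
  position_val (act l s) = (position_val s * letter_ l)%g.
Proof.
have sh dx dy : position_val (shift dx dy s) = (position_val s * plane_val dx dy)%g.
  by rewrite /position_val /= -mulgA plane_valD.
have a1 : gval Ga = plane_val 1 0 by rewrite plane_val.unlock /= mulg1 expg1.
have b1 : gval Gb = plane_val 0 1 by rewrite plane_val.unlock /= mul1g expg1.
have inv x y : ((plane_val x y)^-1 = plane_val (- x)%R (- y)%R)%g.
  apply: (mulgI (plane_val x y)).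
  by rewrite mulgV plane_valD !subrr plane_val.unlock /= mulg1.
case: l => -[] b; rewrite /act /=; try exact: position_val_cross;
  rewrite sh; congr (_ * _)%g; case: b;
  rewrite ?letter_pos ?letter_neg ?gval_c ?gval_d ?a1 ?b1;
  by rewrite ?inv ?plane_valD ?inv.
Qed.

(** Injectivity of the normal form: the position spells out the element. *)
Lemma position_ofK g : position_val (position_of g) = g.
Proof.
rewrite [RHS]word_val_wrepr /position_of.
elim/last_ind: (wrepr g) => [|w l IHw].
  by rewrite /word_val big_nil /position_val plane_val.unlock /= !mulg1.
rewrite -cats1 walk_cat /= position_val_act IHw /word_val big_cat /= big_seq1.
by [].
Qed.

Lemma position_of_inj : injective position_of.
Proof. exact: can_inj position_ofK. Qed.

(** * The word metric *)

Lemma act_stable l s : stable_letter l -> act l s = cross l s.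
Proof. by case: l => -[]. Qed.

Lemma slope_le1 l : `|slope l| <= 1.
Proof. by case: l => -[] []. Qed.

Fixpoint plane_dist (p : seq crossing) (x y : int) : nat :=
  if p is (r, l) :: p' then
    (extend (slope (linv l)) (fun j => plane_dist p' j (r + slope l * j)%R) x y).+1
  else maxn `|x| `|y|.

Lemma plane_dist_lipschitz p (x y x' y' : int) :
  plane_dist p x y <= plane_dist p x' y' + maxn `|x - x'| `|y - y'|.
Proof.
case: p => [|[r l] p] /=; first lia.
by rewrite addSn ltnS extend_lipschitz.
Qed.

Lemma succ_tame f : tame f -> tame (fun j => (f j).+1).
Proof.
case=> lip Qf; split=> [i j|k i j ij]; first by rewrite addSn ltnS lip.
by have := Qf k i j ij; move: (f (i + _)%R) (f (j + _)%R) => a b; lia.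
Qed.

(** The propagation of the invariant through the planes on the way from 1. *)
Lemma plane_dist_line_tame p r l : tame (fun j => plane_dist p j (r + slope l * j)%R).
Proof.
elim: p r l => [|[r' l'] p IHp] r l /=; first exact/sup_norm_tame/slope_le1.
exact/succ_tame/extend_tame/IHp/slope_le1/slope_le1.
Qed.

(** The first coordinate is the homomorphism to Z sending a, c, d to 1 and b, s, t
    to 0, which is bounded by the word length. *)
Lemma plane_dist_ge p (x y : int) : `|x| <= plane_dist p x y.
Proof.
elim: p x y => [|[r l] p IHp] x y /=; first lia.
have [j ->] := extend_ex (slope (linv l)) (fun j => plane_dist p j (r + slope l * j)%R) x y.
by have /= := IHp j (r + slope l * j)%R; lia.
Qed.

Definition origin_dist (s : position) : nat := plane_dist (route s) (xpos s) (ypos s).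

Lemma origin_dist_act l s : origin_dist (act l s) <= (origin_dist s).+1.
Proof.
have sh (dx dy : int) : `|dx| <= 1 -> `|dy| <= 1 ->
    origin_dist (shift dx dy s) <= (origin_dist s).+1.
  by move=> ? ?; have := plane_dist_lipschitz (route s) (xpos s + dx)%R (ypos s + dy)%R
    (xpos s) (ypos s); rewrite /origin_dist /=; lia.
have cr : origin_dist (cross l s) <= (origin_dist s).+1.
  case: s {sh} => p x y.
  case: (boolP (returns (Position p x y) l)) => [/returnsP [r [p' [-> ->]]]|nret].
    rewrite cross_pop /origin_dist /= gen_linvK extend_line; first by rewrite !leqW.
    by have [] := plane_dist_line_tame p' r (linv l).
  rewrite cross_push // /origin_dist /= extend_line ?subrK //.
  by have [] := plane_dist_line_tame p (y - slope l * x)%R l.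
by case: l cr => -[] b // _; apply: sh; case: b.
Qed.

Lemma origin_dist_walk w s : origin_dist (walk w s) <= origin_dist s + size w.
Proof.
elim: w s => [|l w IHw] s /=; first by rewrite addn0.
by have := IHw (act l s); have := origin_dist_act l s; lia.
Qed.

(** The metric of a plane: king moves realize the sup norm. *)
Lemma walk_in_plane n p (x y x' y' : int) : maxn `|x' - x| `|y' - y| = n ->
  exists2 w, size w = n & walk w (Position p x y) = Position p x' y'.
Proof.
elim: n x y => [|n IHn] x y Hn.
  by exists [::] => //=; congr Position; lia.
have [l [dx [dy [El Hn']]]] : exists l (dx dy : int),
    act l (Position p x y) = Position p (x + dx)%R (y + dy)%R /\
    maxn `|(x' - (x + dx))%R| `|(y' - (y + dy))%R| = n.
  case: (ltrgtP x x') => cx; case: (ltrgtP y y') => cy.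
  - by exists (pos Gc), 1%R, 1%R; split=> //; lia.
  - by exists (pos Gd), 1%R, (- 1)%R; split=> //; lia.
  - by exists (pos Ga), 1%R, 0%R; split=> //; lia.
  - by exists (neg Gd), (- 1)%R, 1%R; split=> //; lia.
  - by exists (neg Gc), (- 1)%R, (- 1)%R; split=> //; lia.
  - by exists (neg Ga), (- 1)%R, 0%R; split=> //; lia.
  - by exists (pos Gb), 0%R, 1%R; split=> //; lia.
  - by exists (neg Gb), 0%R, (- 1)%R; split=> //; lia.
  - lia.
have [w <- Hw] := IHn _ _ Hn'.
by exists (l :: w) => //=; rewrite El.
Qed.

Lemma reach_origin_dist s : reduced (route s) ->
  exists2 w, size w = origin_dist s & walk w origin = s.
Proof.
case: s => p x y; rewrite /origin_dist /=.
elim: p x y => [|[r l] p IHp] x y.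
  by move=> _; apply: walk_in_plane; rewrite !subr0.
move=> red /=; have /and3P [Hl redp _] := red.
have [j ->] := extend_ex (slope (linv l)) (fun j => plane_dist p j (r + slope l * j)%R) x y.
have [u Hu Eu] := IHp j (r + slope l * j)%R redp.
have [v Hv Ev] := @walk_in_plane _ ((r, l) :: p) j (slope (linv l) * j)%R x y (erefl _).
exists (u ++ l :: v); first by rewrite size_cat /= Hu Hv addnS.
rewrite walk_cat Eu /= act_stable //.
by rewrite cross_push ?addrK //; apply: reduced_not_returns red _.
Qed.

Lemma word_distE g : word_dist (1%g : G11) g = origin_dist (position_of g).
Proof.
rewrite /word_dist; case: ex_minnP => n /asboolP [w <- Ew] min_n.
apply/eqP; rewrite eqn_leq; apply/andP; split; last first.
  by rewrite Ew mul1g position_of_word; exact: origin_dist_walk.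
have [v Hv Ev] := reach_origin_dist (position_of_reduced g).
apply: min_n; apply/asboolP; exists v => //.
by apply: position_of_inj; rewrite mul1g position_of_word.
Qed.


(** * Strips separate *)

(** With q = (r, l) :: q', the planes reached through the last crossing of q: one
    side of the corresponding strip. *)
Definition beyond (q p : seq crossing) := exists p', p = p' ++ q.

(** Routes change only at their head, so the crossing (r, l) can enter a route
    only when it is performed. *)
Lemma act_beyond q r l m s :
  ~ beyond ((r, l) :: q) (route s) -> beyond ((r, l) :: q) (route (act m s)) ->
  [/\ m = l, route s = q & ypos s = (r + slope l * xpos s)%R].
Proof.
move=> nb.
have cr : beyond ((r, l) :: q) (route (cross m s)) ->
    [/\ m = l, route s = q & ypos s = (r + slope l * xpos s)%R].
  case: s nb => p x y nb.
  case: (boolP (returns (Position p x y) m)) => [/returnsP [r' [p' [Ep Ey]]]|nret].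
    rewrite Ep Ey cross_pop => -[p2 /= E2]; case: nb; rewrite Ep.
    by exists ((r', linv m) :: p2); rewrite E2.
  rewrite cross_push // => -[[|c p2]] /= [].
    by move=> <- -> ->; rewrite subrK.
  by move=> _ Ep; case: nb; exists p2.
by case: m cr => -[] b //.
Qed.

Lemma avoiding_not_beyond (E : G11 * gen -> Prop) q r l g w :
  (forall h j, position_of h = Position q j (r + slope l * j)%R -> E (crossed_edge h l)) ->
  path_avoids E g w -> ~ beyond ((r, l) :: q) (route (position_of g)) ->
  ~ beyond ((r, l) :: q) (route (position_of (g * word_val_ w)%g)).
Proof.
move=> HE; elim: w g => [|m w IHw] g /=; first by rewrite /word_val big_nil mulg1.
case=> nE av nb; rewrite /word_val big_cons mulgA; apply: IHw => //.
rewrite position_of_letter => /(act_beyond nb) [Em Ep Ey]; apply: nE; rewrite Em.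
apply: (HE _ (xpos (position_of g))).
by case: (position_of g) Ep Ey => p x y /= -> ->.
Qed.

Lemma position_of_power (l : letter gen) (dx dy : int) (h : G11) i :
  (forall s, act l s = shift dx dy s) ->
  (forall s, act (linv l) s = shift (- dx)%R (- dy)%R s) ->
  position_of (h * expgz (letter_ l) i)%g =
  shift (dx * i)%R (dy * i)%R (position_of h).
Proof.
move=> El ElV; elim/int_step_ind: i => [|i IHi|i IHi].
- by rewrite !mulr0 mulg1 shift0.
- rewrite expgz_succ mulgA position_of_letter El IHi /shift /=.
  by congr Position; ring.
- rewrite expgz_pred -letter_linv mulgA position_of_letter ElV IHi /shift /=.
  by congr Position; ring.
Qed.

Definition sgn (reversed : bool) : int := if reversed then (- 1)%R else 1%R.

Lemma position_of_a_power (h : G11) b i :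
  position_of (h * expgz (letter_ (Ga, b)) i)%g =
  shift (sgn b * i)%R 0%R (position_of h).
Proof.
rewrite (@position_of_power _ (sgn b) 0%R) ?mul0r // => s.
by case: b.
Qed.

Lemma position_of_target_power u (h : G11) b i :
  position_of (h * expgz (letter_ (stable_target u, b)) i)%g =
  shift (sgn b * i)%R (slope (stable_gen u, true) * (sgn b * i))%R (position_of h).
Proof.
rewrite (@position_of_power _ (sgn b) (slope (stable_gen u, true) * sgn b)%R) ?mulrA //.
  by move=> s; case: u; case: b.
by move=> s; case: u; case: b; rewrite /act /linv /=; congr shift; ring.
Qed.

(** * Patterns *)

(** As f i - i is nonincreasing and bounded below, it is constant from a
    minimum K on, where the slopes become 1; likewise on the left.  The
    finite part of the pattern is cut at the bottom M, with no zeros set apart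
    in the middle. *)
Lemma growing_pattern f C :
  lipschitz f -> almost_convex 1 f -> (forall i : int, `|i| <= f i + C) ->
  has_pattern (fun i => (f (i + 1)%R)%:Z - (f i)%:Z)%R.
Proof.
move=> lip /almost_convex_valley [M [dec inc]] growth.
have [K HK] := argmin_ex (fun i => `|((f i + C)%N%:Z - i)%R|).
have [K' HK'] := argmin_ex (fun i => `|((f i + C)%N%:Z + i)%R|).
have up (i : int) : (K <= i)%R -> f (i + 1)%R = f i + 1.
  move=> Ki; have := HK (i + 1)%R; have := lip i K; have := lip (i + 1)%R i.
  have := growth K; have := growth (i + 1)%R; lia.
have down (i : int) : (i < K')%R -> f i = f (i + 1)%R + 1.
  move=> Ki; have := HK' i; have := lip (i + 1)%R K'; have := lip i (i + 1)%R.
  have := growth K'; have := growth i; lia.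
set q := fun i => _.
pose m := Num.min K' M; pose n1 := `|M - m|%N; pose n2 := `|Num.max K M - M|%N.
pose w a n := [seq q (m + k%:Z)%R | k <- iota a n].
exists m, (w 0 n1), [::], (w n1 n2); split=> //.
- apply/allP => x /mapP [k]; rewrite mem_iota => k1 ->; rewrite /q !inE.
  have := dec (m + k%:Z)%R (m + k%:Z + 1)%R.
  have := lip (m + k%:Z)%R (m + k%:Z + 1)%R; lia.
- apply/allP => x /mapP [k]; rewrite mem_iota => k1 ->; rewrite /q !inE.
  have := inc (m + k%:Z)%R (m + k%:Z + 1)%R.
  have := lip (m + k%:Z + 1)%R (m + k%:Z)%R; lia.
- move=> i im; rewrite /q (down i); lia.
- move=> k; rewrite cat0s /w -map_cat -{2}[n1]add0n -iotaD.
  case: (ltnP k (n1 + n2)) => kn.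
    by rewrite (nth_map 0) ?size_iota // nth_iota // add0n.
  rewrite nth_default ?size_map ?size_iota // /q up; lia.
Qed.

Lemma line_pattern p r l (x0 : int) b :
  has_pattern (fun i =>
    (plane_dist p (x0 + sgn b * (i + 1)) (r + slope l * (x0 + sgn b * (i + 1))))%:Z
    - (plane_dist p (x0 + sgn b * i) (r + slope l * (x0 + sgn b * i)))%:Z)%R.
Proof.
have [lip Qf] := plane_dist_line_tame p r l.
have ge (j : int) := plane_dist_ge p j (r + slope l * j)%R.
move: lip (Qf 0) ge; set f := fun j => plane_dist p j _ => lip Q1 ge.
apply: (growing_pattern (f := fun i => f (x0 + sgn b * i)%R) (C := `|x0|)).
- move=> i j; have := lip (x0 + sgn b * i)%R (x0 + sgn b * j)%R.
  by rewrite /sgn; case: b; lia.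
- case: b; rewrite /sgn => i j ij.
    have E (x : int) : (x0 + -1 * x = x0 - x)%R by lia.
    by rewrite !E; exact: (reflect_almost_convex x0 Q1).
  have E (x : int) : (x0 + 1 * (x + 1%N%:Z) = x0 + 1 * x + 1%N%:Z)%R by lia.
  by rewrite !E; apply: Q1; lia.
- by move=> i; have := ge (x0 + sgn b * i)%R; rewrite /f /sgn; case: b; lia.
Qed.

Lemma has_pattern_ext q q' : q =1 q' -> has_pattern q -> has_pattern q'.
Proof. by move=> /funext ->. Qed.

Theorem theorem9p1 (S : strip) (z : side) (reversed : bool) :
  near_side S z -> has_pattern (side_sequence S z reversed).
Proof.
case: S => g u near_z; set S := Strip g u in near_z *.
case Eg : (position_of g) => [p x y].
have red : reduced p by have := position_of_reduced g; rewrite Eg.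
have a_power b i : position_of (g * expgz (letter_ (Ga, b)) i)%g
    = Position p (x + sgn b * i)%R y.
  by rewrite position_of_a_power Eg /shift /= addr0.
have on_strip h (j : int) :
    position_of h = Position p j y -> strip_edge S (h, stable_gen u).
  move=> Eh; split=> //; exists (j - x)%R; apply: position_of_inj.
  by rewrite Eh (a_power false) /sgn mul1r /=; congr Position; ring.
pose l := (stable_gen u, false).
have Hl : stable_letter l by rewrite /l; case: (u).
have s0 : slope l = 0%R by rewrite /l; case: (u).
have Egu : position_of (g * gval (stable_gen u))%g = cross l (Position p x y).
  by rewrite -letter_pos position_of_letter Eg act_stable.
case: (boolP (returns (Position p x y) l)) => [/returnsP [r [q [Ep Ey]]]|nret].
  (* The plane of g was entered through S, so the terminal side is near. *)
  rewrite Ep in red a_power on_strip Egu; rewrite Ey cross_pop in Egu.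
  rewrite s0 mul0r in Ey.
  case: z near_z => near_z.
    exfalso; have [w av Ew] := near_z 0%R.
    apply: (@avoiding_not_beyond (strip_edge S) q r (linv l) 1%g w) => //.
    - move=> h j Eh; apply: (on_strip _ j); rewrite position_of_letter Eh.
      rewrite act_stable // cross_push; last exact: reduced_not_returns red _.
      by rewrite addrK gen_linvK s0 mul0r Ey.
    - by rewrite position_of1; case=> -[].
    - rewrite -Ew /side_point /side_base /side_label a_power /=; by exists [::].
  apply: has_pattern_ext (line_pattern q r (linv l) x reversed) => i.
  rewrite /side_sequence !word_distE /side_point /side_base /side_label.
  rewrite !position_of_target_power Egu /origin_dist /shift /=.
  by congr (_%:Z - _%:Z)%R; congr plane_dist; rewrite /linv /=; ring.
(* The route to g does not use S, so the initial side is near. *)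
case: z near_z => near_z.
  apply: has_pattern_ext (line_pattern p y l x reversed) => i.
  rewrite /side_sequence !word_distE /side_point /side_base /side_label.
  by rewrite !a_power /origin_dist /= s0 !mul0r !addr0.
exfalso; have [w av Ew] := near_z 0%R.
apply: (@avoiding_not_beyond (strip_edge S) p y l 1%g w) => //.
- move=> h j Eh; apply: (on_strip _ j).
  by rewrite Eh s0 mul0r addr0.
- by rewrite position_of1; case=> -[].
- rewrite -Ew /side_point /side_base /side_label position_of_target_power Egu.
  rewrite cross_push // /shift /= s0 mul0r subr0; by exists [::].
Qed.
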